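(* Let $z_1,z_2,z_3,z_4,z_5\in\mathbb{C}$ be complex numbers lying on the unit circle, i.e. $|z_k|=1$ for $1\leq k\leq 5$. Then $$ S=\left|\int_0^1(1-t)(1-z_1t)(1-z_2t)(1-z_3t)(1-z_4t)(1-z_5t)\,dt\right|\geq\frac{1}{7}. $$ Equality $S=\frac17$ holds if, and only if, one of the following holds: $z_k=1$ for all $1\leq k\leq 5$; or $z_k=e^{i\pi/3}$ for all $1\leq k\leq 5$; or $z_k=e^{-i\pi/3}$ for all $1\leq k\leq 5$.
   Context: Here $i$ denotes the imaginary unit, and the integral is over the real variable $t\in[0,1]$. *)

(* Defs.v *)
From Stdlib Require Export Reals.
From Coquelicot Require Export Coquelicot.
Open Scope R_scope.

(* Coquelicot has no complex exponential: e^(x + iy) = e^x (cos y + i sin y). *)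
Definition Cexp (z : C) : C :=
  (exp (Re z) * cos (Im z), exp (Re z) * sin (Im z)).

(* Main.v *)
Require Import Defs.
From Stdlib Require Import Lra.

(** The integrand is a polynomial in [t] whose coefficients are, up to sign,
    the elementary symmetric functions [e1], ..., [e5] of the [z_k]; since the
    integral of [(1 - t) t^k] is [1 / ((k + 1) (k + 2))] and 420 is the least
    common multiple of these denominators for [k <= 5], the integral is
    [F / 420] for the multiaffine symmetric polynomial
      [F = 210 - 70 e1 + 35 e2 - 21 e3 + 14 e4 - 10 e5],
    and the claim becomes [|F|^2 >= 3600] on the torus.

    This is proved by a sum of squares.  On the torus [conj z_k = / z_k], so
    [|F|^2 - 3600] is a Laurent polynomial with exponents in {-1, 0, 1}, and one
    may look for it among the Hermitian forms in the 32 squarefree monomials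
    that are invariant under permutations of the [z_k].  The space of multiaffine
    polynomials is the fifth tensor power of C^2, and its decomposition under
    the symmetric group offers forms of three kinds, of which two suffice:

    - forms in symmetric polynomials.  They must vanish wherever equality
      holds, that is, when all [z_k] are the same root of
      [(z - 1) (z^2 - z + 1)].  Thus they only involve the polarizations
      of [z^j (z - 1) (z^2 - z + 1)] for [j = 0, 1, 2], which are the
      polynomials [q0], [q1], [q2] below divided by 10;
    - sums over the pairs [i < j] of [|z_i - z_j|^2] times a form in the
      elementary symmetric functions of the three other variables.

    Matching coefficients leaves a small family of candidates, and a member with
    small integer coefficients in which both forms are positive gives the
    identity [sum_of_squares].  Its weights on [|z_i - z_j|^2] are at least 16.
    Hence equality forces all [z_k] to coincide, and then [q1 = 0] says that
    their common value is a root of [(z - 1) (z^2 - z + 1)]. *)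

(** * Squared moduli *)

Definition sqmod (c : C) : R := Cmod c ^ 2.

Lemma sqmod_ge0 (c : C) : 0 <= sqmod c.
Proof. apply pow2_ge_0. Qed.

Ltac sqmod_lra :=
  repeat match goal with |- context [sqmod ?x] =>
    generalize (sqmod_ge0 x); generalize (sqmod x); intros ? ? end;
  lra.

Lemma sqmod_eq0 (c : C) : sqmod c = 0 -> c = 0%C.
Proof.
unfold sqmod; intros h; apply Cmod_eq_0.
rewrite <- Rsqr_pow2 in h; exact (Rsqr_0_uniq _ h).
Qed.

Lemma sqmod0 : sqmod 0%C = 0.
Proof. unfold sqmod; rewrite Cmod_0; ring. Qed.

Lemma sqmod_conj (c : C) : RtoC (sqmod c) = (c * Cconj c)%C.
Proof. apply Cmod2_conj. Qed.

Lemma Cconj_RtoC (r : R) : Cconj (RtoC r) = RtoC r.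
Proof. unfold Cconj, RtoC; simpl; f_equal; ring. Qed.

Lemma unit_conj (z : C) : Cmod z = 1 -> (z * Cconj z = 1)%C.
Proof.
intros h; rewrite <- sqmod_conj; unfold sqmod; rewrite h; f_equal; ring.
Qed.

Lemma Cmult_eq0 (a b : C) : (a * b = 0)%C -> a = 0%C \/ b = 0%C.
Proof.
intros h; destruct (Ceq_dec a 0%C) as [|ha]; [now left|].
destruct (Ceq_dec b 0%C) as [|hb]; [now right|].
destruct (Cmult_neq_0 a b ha hb h).
Qed.

(** * The integral as a symmetric polynomial *)

Definition e1 (z1 z2 z3 z4 z5 : C) : C := (z1 + z2 + z3 + z4 + z5)%C.

Definition e2 (z1 z2 z3 z4 z5 : C) : C :=
  (z1 * z2 + z1 * z3 + z1 * z4 + z1 * z5 + z2 * z3 + z2 * z4 + z2 * z5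
   + z3 * z4 + z3 * z5 + z4 * z5)%C.

Definition e3 (z1 z2 z3 z4 z5 : C) : C :=
  (z1 * z2 * z3 + z1 * z2 * z4 + z1 * z2 * z5 + z1 * z3 * z4 + z1 * z3 * z5
   + z1 * z4 * z5 + z2 * z3 * z4 + z2 * z3 * z5 + z2 * z4 * z5
   + z3 * z4 * z5)%C.

Definition e4 (z1 z2 z3 z4 z5 : C) : C :=
  (z1 * z2 * z3 * z4 + z1 * z2 * z3 * z5 + z1 * z2 * z4 * z5
   + z1 * z3 * z4 * z5 + z2 * z3 * z4 * z5)%C.

Definition e5 (z1 z2 z3 z4 z5 : C) : C := (z1 * z2 * z3 * z4 * z5)%C.

Definition F (z1 z2 z3 z4 z5 : C) : C :=
  (210 - 70 * e1 z1 z2 z3 z4 z5 + 35 * e2 z1 z2 z3 z4 z5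
   - 21 * e3 z1 z2 z3 z4 z5 + 14 * e4 z1 z2 z3 z4 z5
   - 10 * e5 z1 z2 z3 z4 z5)%C.

Lemma is_RInt_moment (k : nat) :
  is_RInt (fun t => (1 - t) * t ^ k) 0 1 (/ ((INR k + 1) * (INR k + 2))).
Proof.
pose proof (pos_INR k) as hk.
pose (P := fun t : R => t ^ S k / (INR k + 1) - t ^ S (S k) / (INR k + 2)).
replace (/ ((INR k + 1) * (INR k + 2))) with (minus (P 1) (P 0)).
- apply (is_RInt_derive (V := R_CompleteNormedModule)); intros t _.
  + unfold P; auto_derive; [trivial|].
    change (match k with 0%nat => 1 | S _ => INR k + 1 end) with (INR (S k)).
    rewrite S_INR; simpl; field; lra.
  + apply (ex_derive_continuous (V := R_NormedModule)); auto_derive; trivial.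
- unfold P, minus, plus, opp; simpl; rewrite !pow1; field; lra.
Qed.

Lemma is_RInt_RtoC_mult (f : R -> R) (a b l : R) (c : C) :
  is_RInt f a b l ->
  is_RInt (V := C_R_NormedModule) (fun t => RtoC (f t) * c)%C a b (RtoC l * c)%C.
Proof.
intros hf.
assert (scaled : forall r, is_RInt (fun t => r * f t) a b (r * l))
  by (intros r; exact (is_RInt_scal f a b r l hf)).
assert (parts : forall x, (RtoC x * c)%C = (fst c * x, snd c * x))
  by (intros x; unfold Cmult, RtoC; simpl; f_equal; ring).
rewrite parts.
apply (is_RInt_ext (V := C_R_NormedModule) (fun t => (fst c * f t, snd c * f t))).
- intros t _; symmetry; apply parts.
- exact (is_RInt_fct_extend_pair (U := R_NormedModule) (V := R_NormedModule)
           (fun t => (fst c * f t, snd c * f t)) a b _ _ (scaled _) (scaled _)).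
Qed.

Lemma is_RInt_integrand (z1 z2 z3 z4 z5 : C) :
  is_RInt (V := C_R_NormedModule)
    (fun t : R =>
       ((1 - t) * (1 - z1 * t) * (1 - z2 * t) * (1 - z3 * t)
        * (1 - z4 * t) * (1 - z5 * t))%C)
    0 1 (RtoC (/ 420) * F z1 z2 z3 z4 z5)%C.
Proof.
assert (moment : forall k (n : R) (c : C), n = 420 / ((INR k + 1) * (INR k + 2)) ->
  is_RInt (V := C_R_NormedModule) (fun t => RtoC ((1 - t) * t ^ k) * c)%C 0 1
    (RtoC (/ 420) * (RtoC n * c))%C).
{ intros k n c ->; rewrite Cmult_assoc, <- RtoC_mult.
  replace (/ 420 * (420 / ((INR k + 1) * (INR k + 2))))
    with (/ ((INR k + 1) * (INR k + 2)))
    by (pose proof (pos_INR k); field; lra).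
  apply is_RInt_RtoC_mult, is_RInt_moment. }
assert (h0 := moment 0%nat 210 1%C ltac:(simpl; field)).
assert (h1 := moment 1%nat 70 (- e1 z1 z2 z3 z4 z5)%C ltac:(simpl; field)).
assert (h2 := moment 2%nat 35 (e2 z1 z2 z3 z4 z5) ltac:(simpl; field)).
assert (h3 := moment 3%nat 21 (- e3 z1 z2 z3 z4 z5)%C ltac:(simpl; field)).
assert (h4 := moment 4%nat 14 (e4 z1 z2 z3 z4 z5) ltac:(simpl; field)).
assert (h5 := moment 5%nat 10 (- e5 z1 z2 z3 z4 z5)%C ltac:(simpl; field)).
pose proof (is_RInt_plus _ _ _ _ _ _ h0 (is_RInt_plus _ _ _ _ _ _ h1
  (is_RInt_plus _ _ _ _ _ _ h2 (is_RInt_plus _ _ _ _ _ _ h3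
  (is_RInt_plus _ _ _ _ _ _ h4 h5))))) as h.
match type of h with is_RInt _ _ _ ?l =>
  assert (hl : @eq C l (RtoC (/ 420) * F z1 z2 z3 z4 z5)%C) end.
{ change (@plus C_R_NormedModule) with Cplus; unfold F; ring. }
rewrite hl in h.
refine (is_RInt_ext _ _ _ _ _ _ h); intros t _.
change (@plus C_R_NormedModule) with Cplus.
match goal with |- ?a = ?b => change (@eq C a b) end.
unfold e1, e2, e3, e4, e5; simpl pow.
rewrite !RtoC_mult, !RtoC_minus; ring.
Qed.

(** * The sum of squares *)

Definition q0 (z1 z2 z3 z4 z5 : C) : C :=
  (-10 + 4 * e1 z1 z2 z3 z4 z5 - 2 * e2 z1 z2 z3 z4 z5
   + e3 z1 z2 z3 z4 z5)%C.

Definition q1 (z1 z2 z3 z4 z5 : C) : C :=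
  (-2 * e1 z1 z2 z3 z4 z5 + 2 * e2 z1 z2 z3 z4 z5
   - 2 * e3 z1 z2 z3 z4 z5 + 2 * e4 z1 z2 z3 z4 z5)%C.

Definition q2 (z1 z2 z3 z4 z5 : C) : C :=
  (- e2 z1 z2 z3 z4 z5 + 2 * e3 z1 z2 z3 z4 z5
   - 4 * e4 z1 z2 z3 z4 z5 + 10 * e5 z1 z2 z3 z4 z5)%C.

(** Up to the factor 4 this is the Hermitian form with Gram matrix
    (5, -7, 3; -7, 13, -7; 3, -7, 5) in [(q0, q1, q2)], diagonalized along the
    reversal [q0 <-> q2]. *)
Definition symmetric_form (z1 z2 z3 z4 z5 : C) : R :=
  let a := q0 z1 z2 z3 z4 z5 in
  let b := q1 z1 z2 z3 z4 z5 in
  let c := q2 z1 z2 z3 z4 z5 in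
  4 * sqmod (a - c) + sqmod (4 * (a + c) - 7 * b) + 3 * sqmod b.

(** A positive form in the elementary symmetric functions [1, s1, s2, s3] of the
    three variables that the pair leaves out.  Its Gram matrix is invariant under
    reversal of the basis, so it splits into forms in [(1 + s3, s1 + s2)] and in
    [(1 - s3, s1 - s2)].  Completing squares in the two leaves [4 |1 + s3|^2] and
    [8 |1 - s3|^2]; as [|1 + s3|^2 + |1 - s3|^2 = 4] on the torus, this is the
    constant 16 together with [4 |1 - s3|^2]. *)
Definition pair_weight (a b c : C) : R :=
  let s1 := (a + b + c)%C in
  let s2 := (a * b + a * c + b * c)%C in
  let s3 := (a * b * c)%C in
  16 + 5 * sqmod (s1 + s2 - 5 * (1 + s3)) + 4 * sqmod (1 - s3)
  + 48 * sqmod (s1 - s2 - 2 * (1 - s3)) + sqmod (s1 - s2 - (1 - s3)).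

Definition spread_form (z1 z2 z3 z4 z5 : C) : R :=
  sqmod (z1 - z2) * pair_weight z3 z4 z5
  + sqmod (z1 - z3) * pair_weight z2 z4 z5
  + sqmod (z1 - z4) * pair_weight z2 z3 z5
  + sqmod (z1 - z5) * pair_weight z2 z3 z4
  + sqmod (z2 - z3) * pair_weight z1 z4 z5
  + sqmod (z2 - z4) * pair_weight z1 z3 z5
  + sqmod (z2 - z5) * pair_weight z1 z3 z4
  + sqmod (z3 - z4) * pair_weight z1 z2 z5
  + sqmod (z3 - z5) * pair_weight z1 z2 z4
  + sqmod (z4 - z5) * pair_weight z1 z2 z3.

(** Writing each squared modulus as [c * conj c] makes both sides polynomials in
    the [z_k] and their conjugates, which agree modulo [z_k * conj z_k = 1]. *)
Lemma sum_of_squares (z1 z2 z3 z4 z5 : C) :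
  Cmod z1 = 1 -> Cmod z2 = 1 -> Cmod z3 = 1 -> Cmod z4 = 1 -> Cmod z5 = 1 ->
  4 * (sqmod (F z1 z2 z3 z4 z5) - 3600) =
  7 * (symmetric_form z1 z2 z3 z4 z5 + spread_form z1 z2 z3 z4 z5).
Proof.
intros h1 h2 h3 h4 h5; apply RtoC_inj.
apply unit_conj in h1, h2, h3, h4, h5.
unfold symmetric_form, spread_form, pair_weight; cbv zeta.
repeat rewrite ?RtoC_plus, ?RtoC_mult, ?RtoC_minus.
rewrite !sqmod_conj; unfold F, q0, q1, q2, e1, e2, e3, e4, e5.
repeat rewrite ?Cplus_conj, ?Cminus_conj, ?Cmult_conj, ?Copp_conj, ?Cconj_RtoC.
ring [h1 h2 h3 h4 h5].
Qed.

Lemma symmetric_form_ge0 (z1 z2 z3 z4 z5 : C) :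
  0 <= symmetric_form z1 z2 z3 z4 z5.
Proof.
unfold symmetric_form; cbv zeta.
sqmod_lra.
Qed.

Lemma pair_weight_ge16 (a b c : C) : 16 <= pair_weight a b c.
Proof.
unfold pair_weight; cbv zeta.
sqmod_lra.
Qed.

Lemma weighted_ge (z w a b c : C) :
  16 * sqmod (z - w) <= sqmod (z - w) * pair_weight a b c.
Proof.
rewrite Rmult_comm; apply Rmult_le_compat_l;
  [apply sqmod_ge0 | apply pair_weight_ge16].
Qed.

Lemma spread_form_lower (z1 z2 z3 z4 z5 : C) :
  16 * (sqmod (z1 - z2) + sqmod (z1 - z3) + sqmod (z1 - z4) + sqmod (z1 - z5))
  <= spread_form z1 z2 z3 z4 z5.
Proof.
unfold spread_form.
repeat match goal with |- context [sqmod (?z - ?w) * pair_weight ?a ?b ?c] =>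
  generalize (weighted_ge z w a b c) (sqmod_ge0 (z - w));
  generalize (sqmod (z - w) * pair_weight a b c); intros ? ? ? end.
lra.
Qed.

(** * The case of equality *)

Lemma symmetric_form_eq0 (w : C) :
  w <> 0%C ->
  symmetric_form w w w w w = 0 -> ((w - 1) * (w * w - w + 1) = 0)%C.
Proof.
intros w0 h.
assert (hq : q1 w w w w w = 0%C).
{ apply sqmod_eq0; revert h; unfold symmetric_form; cbv zeta.
  sqmod_lra. }
assert (hw : (RtoC 10 * w * ((w - 1) * (w * w - w + 1)) = 0)%C)
  by (rewrite <- hq; unfold q1, e1, e2, e3, e4; ring).
destruct (Cmult_eq0 _ _ hw) as [h10 | ?]; [|assumption].
destruct (Cmult_eq0 _ _ h10) as [h10' | ?]; [|contradiction].
apply RtoC_inj in h10'; lra.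
Qed.

Lemma forms_eq0 (w : C) :
  ((w - 1) * (w * w - w + 1) = 0)%C ->
  symmetric_form w w w w w + spread_form w w w w w = 0.
Proof.
intros hw.
assert (h0 : q0 w w w w w = (10 * ((w - 1) * (w * w - w + 1)))%C)
  by (unfold q0, e1, e2, e3; ring).
assert (h1 : q1 w w w w w = (10 * w * ((w - 1) * (w * w - w + 1)))%C)
  by (unfold q1, e1, e2, e3, e4; ring).
assert (h2 : q2 w w w w w = (10 * w * w * ((w - 1) * (w * w - w + 1)))%C)
  by (unfold q2, e2, e3, e4, e5; ring).
unfold symmetric_form, spread_form; cbv zeta; rewrite h0, h1, h2, hw.
repeat match goal with |- context [sqmod ?x] =>
  progress replace x with (RtoC 0) by ring end.
rewrite sqmod0; ring.
Qed.

Lemma sqmod_F_eq_iff (z1 z2 z3 z4 z5 : C) :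
  Cmod z1 = 1 -> Cmod z2 = 1 -> Cmod z3 = 1 -> Cmod z4 = 1 -> Cmod z5 = 1 ->
  sqmod (F z1 z2 z3 z4 z5) = 3600 <->
  (z2 = z1 /\ z3 = z1 /\ z4 = z1 /\ z5 = z1)
  /\ ((z1 - 1) * (z1 * z1 - z1 + 1) = 0)%C.
Proof.
intros u1 u2 u3 u4 u5.
pose proof (sum_of_squares z1 z2 z3 z4 z5 u1 u2 u3 u4 u5) as sos.
split.
- intros hF.
  pose proof (symmetric_form_ge0 z1 z2 z3 z4 z5) as hs.
  pose proof (spread_form_lower z1 z2 z3 z4 z5) as hd.
  pose proof (sqmod_ge0 (z1 - z2)) as p2.
  pose proof (sqmod_ge0 (z1 - z3)) as p3.
  pose proof (sqmod_ge0 (z1 - z4)) as p4.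
  pose proof (sqmod_ge0 (z1 - z5)) as p5.
  assert (z1 = z2) as <- by (apply Ceq_minus, sqmod_eq0; lra).
  assert (z1 = z3) as <- by (apply Ceq_minus, sqmod_eq0; lra).
  assert (z1 = z4) as <- by (apply Ceq_minus, sqmod_eq0; lra).
  assert (z1 = z5) as <- by (apply Ceq_minus, sqmod_eq0; lra).
  split; [now repeat split|].
  apply symmetric_form_eq0; [|lra].
  intros z0; rewrite z0, Cmod_0 in u1; lra.
- intros [(-> & -> & -> & ->) hw].
  rewrite (forms_eq0 _ hw) in sos; lra.
Qed.

Lemma Cexp_imaginary (r : R) : Cexp (Ci * RtoC r) = (cos r, sin r).
Proof.
unfold Cexp, Ci, RtoC, Re, Im; simpl.
replace (0 * r - 1 * 0) with 0 by ring; replace (0 * 0 + 1 * r) with r by ring.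
rewrite exp_0; f_equal; ring.
Qed.

Lemma Cexp_iPI3 : Cexp (Ci * (PI / 3))%C = (1 / 2, sqrt 3 / 2).
Proof.
rewrite <- RtoC_div by lra.
rewrite Cexp_imaginary, cos_PI3, sin_PI3; reflexivity.
Qed.

Lemma Cexp_opp_iPI3 : Cexp (- (Ci * (PI / 3)))%C = (1 / 2, - (sqrt 3 / 2)).
Proof.
rewrite <- RtoC_div by lra.
replace (- (Ci * RtoC (PI / 3)))%C with (Ci * RtoC (- (PI / 3)))%C
  by (rewrite RtoC_opp; ring).
rewrite Cexp_imaginary, cos_neg, sin_neg, cos_PI3, sin_PI3; reflexivity.
Qed.

Lemma extremal_roots (w : C) :
  ((w - 1) * (w * w - w + 1) = 0)%C <->
  w = RtoC 1 \/ w = Cexp (Ci * (PI / 3))%C \/ w = Cexp (- (Ci * (PI / 3)))%C.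
Proof.
rewrite Cexp_iPI3, Cexp_opp_iPI3.
assert (split_quadratic : (w * w - w + 1 =
  (w - (1 / 2, sqrt 3 / 2)%R) * (w - (1 / 2, - (sqrt 3 / 2))%R))%C).
{ pose proof (sqrt_sqrt 3 ltac:(lra)) as s3.
  destruct w as [x y]; unfold Cminus, Cplus, Cmult, Copp, RtoC; simpl.
  f_equal; nra. }
rewrite split_quadratic; split.
- intros h; destruct (Cmult_eq0 _ _ h) as [h1 | h1].
  + left; apply Ceq_minus, h1.
  + destruct (Cmult_eq0 _ _ h1) as [h2 | h2]; right; [left | right];
      apply Ceq_minus, h2.
- intros [-> | [-> | ->]]; ring.
Qed.

Theorem theorem2 :
  forall z1 z2 z3 z4 z5 : C,
    Cmod z1 = 1 -> Cmod z2 = 1 -> Cmod z3 = 1 -> Cmod z4 = 1 -> Cmod z5 = 1 ->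
    let S : R :=
      Cmod (RInt (V := C_R_CompleteNormedModule)
              (fun t : R =>
                 ((1 - t) * (1 - z1 * t) * (1 - z2 * t) * (1 - z3 * t)
                  * (1 - z4 * t) * (1 - z5 * t))%C)
              0 1) in
    let all_equal_to (w : C) : Prop :=
      z1 = w /\ z2 = w /\ z3 = w /\ z4 = w /\ z5 = w in
    S >= 1 / 7 /\
    (S = 1 / 7 <->
       all_equal_to (RtoC 1)
       \/ all_equal_to (Cexp (Ci * (PI / 3))%C)
       \/ all_equal_to (Cexp (- (Ci * (PI / 3)))%C)).
Proof.
intros z1 z2 z3 z4 z5 u1 u2 u3 u4 u5 S all_equal_to.
assert (hS : S = Cmod (F z1 z2 z3 z4 z5) / 420).
{ unfold S.
  rewrite (is_RInt_unique (V := C_R_CompleteNormedModule) _ _ _ _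
             (is_RInt_integrand z1 z2 z3 z4 z5)).
  rewrite Cmod_mult, Cmod_R, Rabs_right by lra; field. }
pose proof (Cmod_ge_0 (F z1 z2 z3 z4 z5)) as F0.
split.
- pose proof (sum_of_squares z1 z2 z3 z4 z5 u1 u2 u3 u4 u5) as sos.
  pose proof (symmetric_form_ge0 z1 z2 z3 z4 z5) as hs.
  pose proof (spread_form_lower z1 z2 z3 z4 z5) as hd.
  pose proof (sqmod_ge0 (z1 - z2)); pose proof (sqmod_ge0 (z1 - z3)).
  pose proof (sqmod_ge0 (z1 - z4)); pose proof (sqmod_ge0 (z1 - z5)).
  assert (3600 <= sqmod (F z1 z2 z3 z4 z5)) as hF by lra.
  unfold sqmod in hF; rewrite hS; nra.
- assert (S = 1 / 7 <-> sqmod (F z1 z2 z3 z4 z5) = 3600) as ->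
    by (unfold sqmod; rewrite hS; split; intros h; nra).
  rewrite sqmod_F_eq_iff, extremal_roots by assumption.
  unfold all_equal_to; split.
  + intros [(-> & -> & -> & ->) [h | [h | h]]]; tauto.
  + intros [h | [h | h]]; destruct h as (-> & -> & -> & -> & ->); tauto.
Qed.
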